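(* For each $d\in\mathbb N$ with $d\geq 2$, there exists a representation of $\mathbb R^d$ as a union of hairs with the following properties: (i) the intersection of any two distinct hairs of the family is either empty or consists of exactly one point, which is the endpoint of both hairs; (ii) the union of the hairs with their endpoints removed has Hausdorff dimension $1$.
   Context: A subset $H\subset\mathbb R^d$ is called a hair if there exists a continuous injective map $\gamma:[0,\infty)\to\mathbb R^d$ with $\lim_{t\to\infty}\gamma(t)=\infty$ (i.e. $\|\gamma(t)\|\to\infty$) and $\gamma([0,\infty))=H$; the point $\gamma(0)$ is called the endpoint of the hair. *)

(* Defs.v *)
From HB Require Import structures.
From mathcomp Require Import all_boot all_order all_algebra.
From mathcomp Require Import all_classical all_reals all_analysis.
Set Implicit Arguments. Unset Strict Implicit. Unset Printing Implicit Defensive.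
Import Order.TTheory GRing.Theory Num.Theory.
Import numFieldNormedType.Exports.
Local Open Scope classical_set_scope.
Local Open Scope ring_scope.

Section Hausdorff.
Variables (R : realType) (d : nat).
Local Notation V := 'rV[R]_d.

Definition enorm (x : V) : R := Num.sqrt (\sum_(i < d) (x ord0 i) ^+ 2).
Definition edist (x y : V) : R := enorm (x - y).

(* Euclidean diameter (in the extended reals; -oo for the empty set) *)
Definition ediam (U : set V) : \bar R :=
  ereal_sup [set (edist x y)%:E | x in U & y in U].

Definition hcost (s : R) (U : set V) : \bar R :=
  if asbool (U = set0) then 0%E
  else match ediam U with
       | r%:E => (r `^ s)%:E
       | _ => +oo%E
       end.

Definition hausdorff_content (s delta : R) (A : set V) : \bar R :=
  ereal_inf [set (\sum_(0 <= n <oo) hcost s (U n))%E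
            | U in [set U : nat -> set V |
                    A `<=` \bigcup_n U n /\ forall n, (ediam (U n) <= delta%:E)%E]].

(* H^s(A) = lim_{delta -> 0+} H^s_delta(A) = sup_{delta > 0} H^s_delta(A) *)
Definition hausdorff_measure (s : R) (A : set V) : \bar R :=
  ereal_sup [set hausdorff_content s delta A | delta in [set delta : R | 0 < delta]].

Definition hausdorff_dim (A : set V) : \bar R :=
  ereal_inf [set s%:E | s in [set s : R | 0 <= s /\ hausdorff_measure s A = 0%E]].

(* gamma : [0,oo) -> R^d is a hair parametrization: continuous, injective,
   and ||gamma t|| -> oo as t -> oo. The hair is gamma([0,oo)), endpoint gamma 0. *)
Definition hair_param (gamma : R -> V) : Prop :=
  {within `[0, +oo[, continuous gamma} /\
  (forall s t, 0 <= s -> 0 <= t -> gamma s = gamma t -> s = t) /\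
  (forall M : R, exists T : R, forall t, T <= t -> M < enorm (gamma t)).

Definition hair_of (gamma : R -> V) : set V := gamma @` [set t | 0 <= t].

End Hausdorff.

(* Main.v *)
Require Import Defs.
From HB Require Import structures.
From mathcomp Require Import all_boot all_order all_algebra.
From mathcomp Require Import all_classical all_reals all_analysis.
From mathcomp Require Import zify ring lra.
Import Order.TTheory GRing.Theory Num.Theory.
Import numFieldNormedType.Exports.
Local Open Scope classical_set_scope.
Local Open Scope ring_scope.

(* Write a point of the half-tube T = [-1,1]^n x [0,oo) as (u, t) and put b(t) = 2
   exp(2t). At height t divide [-b(t), b(t)] at the odd integers and rescale to
   [-1,1], labelling the cell [2k-1, 2k+1] by k; as t grows, cells get thinner and
   new ones are born at the ends. The products of the cells labelled k_1, ..., k_n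
   form a thin tube, born when b(t) = B(k) := max(2, max_i (2|k_i| - 1)), which is
   mapped onto T by affine maps in u and by t |-> b(t)/B(k) - 1 in height. Iterating
   gives every point of T an address. Heights do not depend on u and the maps
   contract in u, so the points with a given address form the graph of a continuous
   function of the height over a ray: this is a hair.

   If x lies strictly above y on a hair, the height differences of their orbits tend
   to infinity, so the heights of x escape. Side walls are mapped to side walls, and
   a tube is met on a wall only just after its birth; hence points other than
   endpoints never meet a wall and have a unique address. Moreover the heights of the
   orbit of y are negligible compared to those of x, so the tubes met by x were all
   born early: of the tubes crossing height t only about exp(eps t) matter, each
   split into about exp(2t) pieces of size about exp(-2t), which gives dimension at
   most 1 for the open hairs. The projection to the height gives dimension at least
   1. Translates of T and of its mirror image fill the space. *)

(** * Truncation to the interval [-1, 1] *)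

Section Clamp.
Context {R : realType}.
Implicit Types x y r : R.

Definition clamp x : R := Num.max (-1) (Num.min 1 x).

Variant clamp_spec x : R -> Type :=
  | ClampLow of x <= -1 : clamp_spec x (-1)
  | ClampMid of -1 <= x & x <= 1 : clamp_spec x x
  | ClampHigh of 1 <= x : clamp_spec x 1.

Lemma clampP x : clamp_spec x (clamp x).
Proof.
rewrite /clamp; case: (leP 1 x) => x1.
  by rewrite max_r; [constructor | lra].
by case: (leP (-1) x) => x2; constructor; lra.
Qed.

Lemma clamp_ge x : -1 <= clamp x.
Proof. do ?case: clampP; lra. Qed.

Lemma clamp_le x : clamp x <= 1.
Proof. do ?case: clampP; lra. Qed.

Lemma clamp_id x : -1 <= x -> x <= 1 -> clamp x = x.
Proof. do ?case: clampP; lra. Qed.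

Lemma clamp_mono x y : x <= y -> clamp x <= clamp y.
Proof. do ?case: clampP; lra. Qed.

Lemma clamp_lip x y : x <= y -> clamp y - clamp x <= y - x.
Proof. do ?case: clampP; lra. Qed.

Lemma clamp_lt1 x : x < 1 -> clamp x < 1.
Proof. do ?case: clampP; lra. Qed.

Lemma clamp_gtN1 x : -1 < x -> -1 < clamp x.
Proof. do ?case: clampP; lra. Qed.

Lemma clamp_lt x y : x < y -> x < 1 -> -1 < y -> clamp x < clamp y.
Proof. do ?case: clampP; lra. Qed.

(** The truncation makes the bound independent of [x]: for [x >= 1] the first value is 1 and the
    second at least [r], and symmetrically below -1. *)
Lemma clamp_scale x r : 0 <= r -> r <= 1 -> `|clamp x - clamp (x * r)| <= 1 - r.
Proof.
move=> r0 r1; set y := x * r.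
(* Each case keeps only linear consequences of the product, so linear arithmetic can finish once the
   truncations are unfolded. *)
have : [\/ 1 <= x /\ r <= y, [/\ 0 <= x, x <= 1, 0 <= y, y <= x & x - y <= 1 - r],
   [/\ x <= 0, -1 <= x, y <= 0, x <= y & y - x <= 1 - r] | x <= -1 /\ y <= - r].
  rewrite /y; have [x1|x1] := leP 1 x; first by constructor 1; split=> //; nra.
  have [x0|x0] := leP 0 x; first by constructor 2; split; nra.
  have [xN|xN] := leP (-1) x; first by constructor 3; split; nra.
  by constructor 4; split; nra.
move: y => y H; rewrite ler_distlC; clear -H r0 r1.
by case: H => [[? ?]|[? ? ? ? ?]|[? ? ? ? ?]|[? ?]]; apply/andP; split; do ?case: clampP; lra.
Qed.

End Clamp.

(** * Splitting a cross-section into cells *)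

Section Cells.
Context {R : realType}.
Implicit Types (c t v : R).

(* [1 / b(t)] for [t >= 0]; [t] is truncated at 0 so that all estimates hold for every [t]. *)
Definition scale t : R := expR (- (2 * Num.max t 0)) / 2.

(** Rescaled position of the wall at [c]; a wall not yet born sits at -1 or 1. *)
Definition barrier c t : R := clamp (c * scale t).

(** The affine map of [-1, 1] onto the rescaled cell centred at [c]; it is constant as long as the
    two barriers coincide. *)
Definition cell c t v : R :=
  barrier (c - 1) t + (barrier (c + 1) t - barrier (c - 1) t) * ((1 + v) / 2).

Lemma scale_gt0 t : 0 < scale t.
Proof. by rewrite /scale divr_gt0// expR_gt0. Qed.

Lemma scale_le t : scale t <= 2^-1.
Proof.
rewrite /scale -[leRHS]mul1r ler_pM2r ?invr_gt0//.
by rewrite expR_le1 oppr_le0 mulr_ge0// le_max lexx orbT.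
Qed.

Lemma scaleE t : 0 <= t -> scale t = (2 * expR (2 * t))^-1.
Proof. by move=> t0; rewrite /scale max_l// expRN invfM mulrC. Qed.

(** Truncation at 0 does not enlarge height differences, and [1 - exp(-2D) <= 2D]. *)
Lemma scale_decay t t' : t <= t' ->
  exists r, [/\ 0 <= r, r <= 1, 1 - r <= 2 * (t' - t) & scale t' = scale t * r].
Proof.
move=> tt'; pose D := Num.max t' 0 - Num.max t 0.
have D0 : 0 <= D by rewrite /D !maxEle; case: (leP t' 0); case: (leP t 0); lra.
have Dle : D <= t' - t by rewrite /D !maxEle; case: (leP t' 0); case: (leP t 0); lra.
exists (expR (- (2 * D))); split.
- exact: expR_ge0.
- by rewrite expR_le1; lra.
- by have := expR_ge1Dx (- (2 * D)); lra.
- by rewrite /scale mulrAC -expRD; congr (expR _ / 2); rewrite /D; ring.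
Qed.

Lemma barrier_ge c t : -1 <= barrier c t. Proof. exact: clamp_ge. Qed.

Lemma barrier_le c t : barrier c t <= 1. Proof. exact: clamp_le. Qed.

Lemma barrier_mono c c' t : c <= c' -> barrier c t <= barrier c' t.
Proof. by move=> cc'; apply: clamp_mono; rewrite ler_wpM2r// ltW// scale_gt0. Qed.

Lemma barrier_width c t : barrier (c + 1) t - barrier (c - 1) t <= 2 * scale t.
Proof.
apply: le_trans (clamp_lip _ _ _) _; last by lra.
by rewrite ler_wpM2r ?(ltW (scale_gt0 _))//; lra.
Qed.

(** The constant does not depend on [c], because a wall moves only while it is inside [-1, 1], where
    a relative decay of the scale is also an absolute bound. *)
Lemma barrier_lip c t t' : `|barrier c t - barrier c t'| <= 2 * `|t - t'|.
Proof.
wlog tt' : t t' / t <= t'.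
  move=> H; have [tt'|/ltW tt'] := leP t t'; first exact: H.
  by rewrite distrC (distrC t); exact: H.
have [r [r0 r1 r2 er]] := scale_decay _ _ tt'.
rewrite /barrier er mulrA (le_trans (clamp_scale _ _ r0 r1))//.
by rewrite ler0_norm; lra.
Qed.

Lemma cell_ge c t v : -1 <= v -> v <= 1 -> -1 <= cell c t v.
Proof.
move=> v1 v2; have := barrier_mono (c - 1) (c + 1) t ltac:(lra).
by have := barrier_ge (c - 1) t; rewrite /cell; nra.
Qed.

Lemma cell_le c t v : -1 <= v -> v <= 1 -> cell c t v <= 1.
Proof.
move=> v1 v2; have := barrier_mono (c - 1) (c + 1) t ltac:(lra).
by have := barrier_le (c + 1) t; rewrite /cell; nra.
Qed.

Lemma cell_between c t v : -1 <= v -> v <= 1 ->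
  barrier (c - 1) t <= cell c t v <= barrier (c + 1) t.
Proof.
move=> v1 v2; have := barrier_mono (c - 1) (c + 1) t ltac:(lra).
by move=> ?; apply/andP; split; rewrite /cell; nra.
Qed.

Lemma cell_contract c t v v' :
  `|cell c t v - cell c t v'| <= scale t * `|v - v'|.
Proof.
have -> : cell c t v - cell c t v' =
    (barrier (c + 1) t - barrier (c - 1) t) / 2 * (v - v') by rewrite /cell; lra.
rewrite normrM ler_wpM2r// ger0_norm.
  by have := barrier_width c t; lra.
by have := barrier_mono (c - 1) (c + 1) t ltac:(lra); lra.
Qed.

Lemma cell_lip c t t' v v' : -1 <= v' -> v' <= 1 ->
  `|cell c t v - cell c t' v'| <= scale t * `|v - v'| + 2 * `|t - t'|.
Proof.
move=> v1 v2; rewrite -(subrKA (cell c t v')).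
apply: le_trans (ler_normD _ _) _; rewrite lerD ?cell_contract//.
(* For fixed [v'] the cell map is a convex combination of two barriers and inherits their Lipschitz
   constant. *)
have -> : cell c t v' - cell c t' v' =
    (barrier (c - 1) t - barrier (c - 1) t') * ((1 - v') / 2) +
    (barrier (c + 1) t - barrier (c + 1) t') * ((1 + v') / 2) by rewrite /cell; lra.
have normrMp (x y : R) : 0 <= y -> `|x * y| = `|x| * y.
  by move=> y0; rewrite normrM (ger0_norm y0).
apply: le_trans (ler_normD _ _) _; rewrite !normrMp; [|by lra..].
by have := barrier_lip (c - 1) t t'; have := barrier_lip (c + 1) t t'; nra.
Qed.

Lemma cell_mono c t v v' : v <= v' -> cell c t v <= cell c t v'.
Proof.
by move=> vv'; have := barrier_mono (c - 1) (c + 1) t ltac:(lra); rewrite /cell; nra.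
Qed.

(** The hypothesis says that (c - 1, c + 1) meets (-b(t), b(t)), so the cell has positive width
    after rescaling. *)
Lemma barrier_lt c t : 0 <= t -> `|c| - 1 < 2 * expR (2 * t) ->
  barrier (c - 1) t < barrier (c + 1) t.
Proof.
move=> t0 ct; have e0 := @expR_gt0 R (2 * t).
have := ler_norm c; have := ler_norm (- c); rewrite normrN => c1 c2.
rewrite /barrier scaleE//; apply: clamp_lt.
- by rewrite ltr_pM2r ?invr_gt0 ?mulr_gt0//; lra.
- by rewrite ltr_pdivrMr ?mulr_gt0//; lra.
- by rewrite ltr_pdivlMr ?mulr_gt0//; lra.
Qed.

Lemma cell_inj c t v v' : barrier (c - 1) t < barrier (c + 1) t ->
  cell c t v = cell c t v' -> v = v'.
Proof.
rewrite -subr_gt0 => h /addrI /(mulfI (lt0r_neq0 h)) /(congr1 ( *%R^~ 2)).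
by rewrite !divfK//; lra.
Qed.

(* Side walls are mapped to side walls, and a cell that touches one has just been born. *)
Lemma cell_wall c t v : 0 <= t -> `|c| - 1 < 2 * expR (2 * t) ->
  -1 <= v -> v <= 1 -> `|cell c t v| = 1 ->
  `|v| = 1 /\ 2 * expR (2 * t) <= `|c| + 1.
Proof.
move=> t0 ct v1 v2; have lt := barrier_lt _ _ t0 ct; have e0 := @expR_gt0 R (2 * t).
have E : 0 < 2 * expR (2 * t) by rewrite mulr_gt0.
have := ler_norm c; have := ler_norm (- c); rewrite normrN => c1 c2.
have [le1 le2] := (barrier_ge (c - 1) t, barrier_le (c + 1) t).
have [le3 le4] : -1 <= cell c t v /\ cell c t v <= 1.
  by split; [exact: cell_ge | exact: cell_le].
have [p0|p0] := leP 0 (cell c t v).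
  rewrite ger0_norm// => e1.
  have -> : v = 1.
    have vc : cell c t 1 <= cell c t v.
      by rewrite e1; apply: cell_le; lra.
    have : cell c t v <= cell c t 1 by exact: cell_mono.
    by move=> vc'; apply: (cell_inj c t) => //; apply/le_anti; rewrite vc vc'.
  split; first by rewrite normr1.
  rewrite leNgt; apply/negP => h.
  have : barrier (c + 1) t < 1.
    by apply: clamp_lt1; rewrite scaleE// ltr_pdivrMr//; lra.
  by have /andP[_] := cell_between c t v v1 v2; rewrite e1; lra.
rewrite ltr0_norm// => e1.
have -> : v = -1.
  have vc : cell c t v <= cell c t (-1).
    have -> : cell c t v = -1 by lra.
    by apply: cell_ge; lra.
  have : cell c t (-1) <= cell c t v by exact: cell_mono.
  by move=> vc'; apply: (cell_inj c t) => //; apply/le_anti; rewrite vc vc'.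
split; first by rewrite normrN normr1.
rewrite leNgt; apply/negP => h.
have : -1 < barrier (c - 1) t.
  by apply: clamp_gtN1; rewrite scaleE// ltr_pdivlMr//; lra.
by have /andP[+ _] := cell_between c t v v1 v2; lra.
Qed.

Lemma cell_surj t x : 0 <= t -> -1 <= x -> x <= 1 ->
  exists (k : int) v, [/\ `|2 * k%:~R| - 1 <= 2 * expR (2 * t),
    -1 <= v, v <= 1 & x = cell (2 * k%:~R) t v].
Proof.
move=> t0 x1 x2; set b := 2 * expR (2 * t).
have b0 : 0 < b by rewrite mulr_gt0// expR_gt0.
(* The label for which [b * x] lies in [2k - 1, 2k + 1). *)
pose k := Num.floor ((b * x + 1) / 2).
have k1 : 2 * k%:~R - 1 <= b * x.
  by have /andP[+ _] := Num.Theory.floor_itv ((b * x + 1) / 2); rewrite -/k; lra.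
have k2 : b * x < 2 * k%:~R + 1.
  by have := floorD1_gt ((b * x + 1) / 2); rewrite -/k intrD; lra.
have bx1 : b * x <= b by rewrite ger_pMr.
have bx2 : - b <= b * x by rewrite -mulrN1 ler_pM2l.
have cx : barrier (2 * k%:~R - 1) t <= x.
  rewrite -[leRHS]clamp_id//; apply: clamp_mono.
  by rewrite scaleE// ler_pdivrMr// (mulrC x).
have xc : x <= barrier (2 * k%:~R + 1) t.
  rewrite -[leLHS]clamp_id//; apply: clamp_mono.
  by rewrite scaleE// ler_pdivlMr// (mulrC x) ltW.
have kb : `|2 * (k%:~R : R)| - 1 <= b by rewrite lerBlDr ler_norml; lra.
move: cx xc; set lo := barrier _ t; set hi := barrier _ t => cx xc.
(* If the cell is degenerate, both barriers equal [x] and any [v] will do. *)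
have [hl|hl] := leP hi lo.
  by exists k, 0; split=> //; [lra..|]; rewrite /cell -/lo -/hi; lra.
have hl' : hi - lo != 0 by lra.
exists k, (2 * ((x - lo) / (hi - lo)) - 1); split=> //.
- by have : 0 <= (x - lo) / (hi - lo); [rewrite divr_ge0; lra | lra].
- by have : (x - lo) / (hi - lo) <= 1; [rewrite ler_pdivrMr; lra | lra].
- by rewrite /cell -/lo -/hi; field.
Qed.

Lemma barrier_continuous c : continuous (barrier c).
Proof.
move=> t; apply/cvgrPdist_le => e e0; near=> s.
apply: le_trans (barrier_lip _ _ _) _; rewrite -ler_pdivlMl// .
near: s; apply: (@cvgr_dist_le _ _ _ _ _ id t) => //.
by rewrite mulr_gt0.
Unshelve. all: by end_near. Qed.

End Cells.

(** * Addresses, heights and positions *)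

Section Addresses.
Context {R : realType} {n : nat}.
Local Notation symbol := {ffun 'I_n -> int}.
Local Notation address := (nat -> symbol).
Implicit Types (k : symbol) (a b : address) (t x y : R) (i : 'I_n) (m N : nat).

Definition center k i : R := 2 * (k i)%:~R.

Definition birth k : R := \big[Num.max/2]_(i < n) (`|center k i| - 1).

Definition climb k t : R := 2 * expR (2 * t) / birth k - 1.

Definition shift a : address := fun m => a m.+1.

Fixpoint height a m t : R :=
  if m is m'.+1 then climb (a m') (height a m' t) else t.

Definition valid a t := forall m, 0 <= height a m t.

(* Starting at -1 makes the sequence of approximations nondecreasing. *)
Fixpoint approx a N i t : R :=
  if N is N'.+1 then cell (center (a 0%N) i) t (approx (shift a) N' i (climb (a 0%N) t))
  else -1.

Definition trace a i t : R := sup (range (fun N => approx a N i t)).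

Lemma birth_ge2 k : 2 <= birth k.
Proof. exact: bigmax_ge_id. Qed.

Lemma birth_gt0 k : 0 < birth k.
Proof. by apply: lt_le_trans (birth_ge2 k). Qed.

Lemma birth_ge k i : `|center k i| - 1 <= birth k.
Proof. by rewrite /birth; apply: le_bigmax. Qed.

Lemma birth_le k x : 2 <= x -> (forall i, `|center k i| - 1 <= x) -> birth k <= x.
Proof. by move=> x2 kx; apply: bigmax_le. Qed.

Lemma climb_ge0 k t : (0 <= climb k t) = (birth k <= 2 * expR (2 * t)).
Proof. by rewrite subr_ge0 ler_pdivlMr ?birth_gt0// mul1r. Qed.

Lemma climb_gt0 k t : (0 < climb k t) = (birth k < 2 * expR (2 * t)).
Proof. by rewrite subr_gt0 ltr_pdivlMr ?birth_gt0// mul1r. Qed.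

(** All expansion estimates for heights rest on this identity: [climb + 1] is proportional to
    exp(2t). *)
Lemma climb_ratio k x y : climb k x + 1 = (climb k y + 1) * expR (2 * (x - y)).
Proof.
have e : 2 * x = 2 * y + 2 * (x - y) by ring.
by rewrite /climb !subrK e expRD mulrA mulrAC.
Qed.

Lemma climb_gap k x y : 0 <= climb k y -> y <= x ->
  2 * (x - y) <= climb k x - climb k y.
Proof.
move=> y0 yx; have := climb_ratio k x y.
by have := expR_ge1Dx (2 * (x - y)); nra.
Qed.

Lemma climb_mono k x y : x <= y -> climb k x <= climb k y.
Proof.
move=> xy; rewrite /climb lerD2r ler_pM2r ?invr_gt0 ?birth_gt0//.
by rewrite ler_pM2l// ler_expR; lra.
Qed.

Lemma climb_continuous k : continuous (climb k).
Proof.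
move=> t; apply: cvgD; last exact: cvg_cst.
apply: cvgM; last exact: cvg_cst; apply: cvgM; first exact: cvg_cst.
apply: (continuous_comp (f := fun t => 2 * t)); last exact: continuous_expR.
by apply: cvgM; [exact: cvg_cst|exact: cvg_id].
Qed.

Lemma height_shift a m t : height a m.+1 t = height (shift a) m (climb (a 0%N) t).
Proof. by elim: m => //= m ->. Qed.

Lemma height_mono a m x y : x <= y -> height a m x <= height a m y.
Proof. by move=> xy; elim: m => //= m; exact: climb_mono. Qed.

(** Validity at the lower height keeps [climb + 1 >= 1] along its orbit, so each step at least
    doubles the gap. *)
Lemma height_gap a m x y : valid a y -> y <= x ->
  2 ^+ m * (x - y) <= height a m x - height a m y.
Proof.
move=> vy yx; elim: m => [|m IH]; first by rewrite expr0 mul1r.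
rewrite exprS /= -mulrA; apply: le_trans (climb_gap _ _ _ (vy m.+1) _).
  by rewrite ler_pM2l.
exact: height_mono.
Qed.

Lemma height_continuous a m : continuous (height a m).
Proof.
elim: m => [|m IH] t; first exact: cvg_id.
exact: (continuous_comp (IH t) (climb_continuous _ _)).
Qed.

Lemma valid_ge0 a t : valid a t -> 0 <= t.
Proof. by move/(_ 0%N). Qed.

Lemma valid_mono a x y : x <= y -> valid a x -> valid a y.
Proof. by move=> xy vx m; apply: le_trans (vx m) (height_mono _ _ _ _ xy). Qed.

Lemma valid_shift a t : valid a t -> valid (shift a) (climb (a 0%N) t).
Proof. by move=> va m; rewrite -height_shift. Qed.

(** The two bounds are proved together, since either bound for a cell needs both bounds for its
    argument. *)
Lemma approx_ge a N i t : -1 <= approx a N i t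
with approx_le a N i t : approx a N i t <= 1.
Proof.
  by case: N => [|N]//=; apply: cell_ge.
by case: N => [|N]/=; [lra | apply: cell_le].
Qed.

Lemma approx_nd a i t : nondecreasing_seq (fun N => approx a N i t).
Proof.
apply/nondecreasing_seqP => N; elim: N a t => [|N IH] a t; first exact: approx_ge.
exact: cell_mono.
Qed.

Lemma trace_cvg a i t : (fun N => approx a N i t) @ \oo --> trace a i t.
Proof.
apply: nondecreasing_cvgn; first exact: approx_nd.
by exists 1 => _ [N _ <-]; exact: approx_le.
Qed.

Lemma trace_le a i t : trace a i t <= 1.
Proof.
apply: ge_sup; first by exists (approx a 0 i t), 0%N.
by move=> _ [N _ <-]; exact: approx_le.
Qed.

Lemma trace_ge a i t : -1 <= trace a i t.
Proof.
apply: ub_le_sup; last by exists 0%N.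
by exists 1 => _ [N _ <-]; exact: approx_le.
Qed.

(** The recursion for [approx] passes to the limit because a cell map is affine in its last
    argument. *)
Lemma trace_rec a i t :
  trace a i t = cell (center (a 0%N) i) t (trace (shift a) i (climb (a 0%N) t)).
Proof.
have := trace_cvg a i t; rewrite -cvg_shiftS /= => /cvg_lim <-//.
apply/cvg_lim => //; apply: cvgD; first exact: cvg_cst.
apply: cvgM; first exact: cvg_cst; apply: cvgM; last exact: cvg_cst.
by apply: cvgD; [exact: cvg_cst|exact: trace_cvg].
Qed.

Lemma cell_half c t v v' : `|cell c t v - cell c t v'| <= 2^-1 * `|v - v'|.
Proof.
apply: le_trans (cell_contract _ _ _ _) _.
by rewrite ler_wpM2r// scale_le.
Qed.

(** Both sequences start within distance 2 at depth [N], and each of the [N] cell maps halves the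
    distance. *)
Lemma approx_dist a i t N (v : nat -> R) :
  (forall m, -1 <= v m <= 1) ->
  (forall m, v m = cell (center (a m) i) (height a m t) (v m.+1)) ->
  `|v 0%N - approx a N i t| <= 2 * 2^-1 ^+ N.
Proof.
elim: N a t v => [|N IH] a t v vb vrec /=.
  by have /andP[? ?] := vb 0%N; rewrite expr0 ger0_norm; lra.
rewrite (vrec 0%N) /= exprS mulrCA; apply: le_trans (cell_half _ _ _ _) _.
rewrite ler_pM2l//; apply: (IH (shift a) _ (fun m => v m.+1)) => // m.
by rewrite vrec -height_shift.
Qed.

Lemma iter_shift a m j : iter m shift a j = a (m + j)%N.
Proof. by elim: m j => // m IH j; rewrite iterS /shift IH addnS. Qed.

Lemma height_iter a m t : climb (iter m shift a 0%N) (height a m t) = height a m.+1 t.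
Proof. by rewrite iter_shift addn0. Qed.

Lemma trace_iter a i m t : trace (iter m shift a) i (height a m t) =
  cell (center (a m) i) (height a m t) (trace (iter m.+1 shift a) i (height a m.+1 t)).
Proof. by rewrite trace_rec height_iter iter_shift addn0. Qed.

Lemma trace_approx a i t N : `|trace a i t - approx a N i t| <= 2 * 2^-1 ^+ N.
Proof.
apply: (@approx_dist a i t N (fun m => trace (iter m shift a) i (height a m t))).
  by move=> m; rewrite trace_ge trace_le.
by move=> m; rewrite [LHS]trace_iter.
Qed.

Lemma geometric_small e : 0 < e -> exists N, 2 * 2^-1 ^+ N <= e :> R.
Proof.
move=> e0; have : (fun N => 2 * 2^-1 ^+ N : R) @ \oo --> (0 : R).
  rewrite -(mulr0 2); apply: cvgM; first exact: cvg_cst.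
  by apply: cvg_expr; rewrite ger0_norm ?invr_ge0// invf_lt1//; lra.
move/cvgr0Pnorm_le => /(_ e e0) [N _ /(_ N)] /= /(_ (leqnn N)) h; exists N.
by apply: le_trans (ler_norm _) h.
Qed.

(** By contraction the recursion has only one bounded solution. This identifies the trace of an
    address built symbol by symbol. *)
Lemma trace_unique a i t (v : nat -> R) :
  (forall m, -1 <= v m <= 1) ->
  (forall m, v m = cell (center (a m) i) (height a m t) (v m.+1)) ->
  v 0%N = trace a i t.
Proof.
move=> vb vrec; apply/eqP; rewrite -subr_eq0 -normr_le0; apply/ler_addgt0Pl => e e0.
have [N Ne] := geometric_small (e / 2) (divr_gt0 e0 (ltr0n _ 2)).
have := approx_dist a i t N v vb vrec; have := trace_approx a i t N.
rewrite distrC addr0 => h1 h2.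
by have := ler_distD (approx a N i t) (v 0%N) (trace a i t); lra.
Qed.

Lemma approx_continuous a N i : continuous (approx a N i).
Proof.
elim: N a => [|N IH] a t; first exact: cvg_cst.
apply: cvgD; first exact: barrier_continuous.
apply: cvgM; first by apply: cvgB; exact: barrier_continuous.
apply: cvgM; last exact: cvg_cst; apply: cvgD; first exact: cvg_cst.
exact: (continuous_comp (climb_continuous _ _) (IH _ _)).
Qed.

(** A uniform limit of continuous functions: the error of [approx] does not depend on the height. *)
Lemma trace_continuous a i : continuous (trace a i).
Proof.
move=> t; apply/cvgrPdist_le => e e0.
have [N Ne] := geometric_small (e / 3) (divr_gt0 e0 (ltr0n _ 3)).
have /cvgrPdist_le /(_ (e / 3) (divr_gt0 e0 (ltr0n _ 3))) := approx_continuous a N i t.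
apply: filterS => s h; have := trace_approx a i t N; have := trace_approx a i s N.
rewrite (distrC (trace a i s)) => h1 h2.
have := ler_distD (approx a N i t) (trace a i t) (trace a i s).
by have := ler_distD (approx a N i s) (approx a N i t) (trace a i s); lra.
Qed.

End Addresses.

(** * The hair with a given address *)

Section AbstractHairs.
Context {R : realType} {n : nat}.
Local Notation symbol := {ffun 'I_n -> int}.
Local Notation address := (nat -> symbol).
Implicit Types (k : symbol) (a b : address) (t x y : R) (i : 'I_n) (m N : nat).

Definition start a : R := inf [set t | valid a t].

Lemma start_le a t : valid a t -> start a <= t.
Proof. by move=> va; apply: ge_inf => //; exists 0 => s; exact: valid_ge0. Qed.

(** Valid heights form a closed set: a negative iterate at the infimum would remain negative at
    valid heights nearby. *)
Lemma start_valid a t : valid a t -> valid a (start a).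
Proof.
move=> va m; rewrite leNgt; apply/negP => h.
have hi : has_inf [set s : R | valid a s].
  by split; [exists t | exists 0 => s; exact: valid_ge0].
have /cvgr_lt /(_ _ h) := height_continuous a m (start a).
case/nbhs_ballP => e /= e0 he.
have [s vs se] := inf_adherent e0 hi.
have := vs m; rewrite leNgt => /negP; apply; apply: he.
rewrite /ball /= ler0_norm ?subr_le0 ?start_le//.
by rewrite -/(start a) in se; lra.
Qed.

(** A point strictly inside a nondegenerate cell lies strictly between its barriers, while every
    other closed cell stays on one side of them. *)
Lemma cell_symbol (p q : int) t (v w : R) :
  barrier (2 * p%:~R - 1) t < barrier (2 * p%:~R + 1) t ->
  -1 < v -> v < 1 -> -1 <= w -> w <= 1 ->
  cell (2 * p%:~R) t v = cell (2 * q%:~R) t w -> p = q.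
Proof.
move=> lt v1 v2 w1 w2 e; have /andP[q1 q2] := cell_between (2 * q%:~R) t w w1 w2.
have d0 : 0 < barrier (2 * p%:~R + 1) t - barrier (2 * p%:~R - 1) t by lra.
have e1 : barrier (2 * p%:~R - 1) t < cell (2 * p%:~R) t v.
  by rewrite /cell ltrDl mulr_gt0//; lra.
have e2 : cell (2 * p%:~R) t v < barrier (2 * p%:~R + 1) t.
  by rewrite /cell -ltrBrDl gtr_pMr//; lra.
have step (j l : int) : (j + 1 <= l) -> barrier (2 * j%:~R + 1) t <= barrier (2 * l%:~R - 1) t.
  by move=> jl; apply: barrier_mono; have : ((j + 1)%:~R : R) <= l%:~R;
    [rewrite ler_int | rewrite intrD; lra].
rewrite e in e1 e2; case: (ltgtP p q) => // pq.
  have := step p q; rewrite lezD1 => /(_ pq) h.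
  by have := lt_le_trans e2 (le_trans h q1); rewrite ltxx.
have := step q p; rewrite lezD1 => /(_ pq) h.
by have := lt_le_trans e1 (le_trans q2 h); rewrite ltxx.
Qed.

Lemma height_pos a m y t : valid a y -> y < t -> 0 < height a m t.
Proof.
move=> vy yt; have := height_gap a m t y vy (ltW yt); have := vy m.
have : 0 < 2 ^+ m * (t - y) by rewrite mulr_gt0 ?exprn_gt0// subr_gt0.
lra.
Qed.

Lemma gap_large a y t C : valid a y -> y < t ->
  exists N, forall m, (N <= m)%N -> C <= height a m t - height a m y.
Proof.
move=> vy yt; have D0 : 0 < t - y by rewrite subr_gt0.
(* The gap after [m] steps is at least 2^m (t - y), and 2^m > m. *)
exists (Num.truncn `|C / (t - y)|).+1 => m Nm.
apply: le_trans (height_gap a m t y vy (ltW yt)); rewrite -ler_pdivrMr//.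
apply: le_trans (ler_norm _) _.
have h : `|C / (t - y)| <= m%:R.
  by apply/ltW; apply: lt_le_trans (truncnS_gt _) _; rewrite ler_nat.
apply: le_trans h _; rewrite -natrX ler_nat; apply/ltnW; exact: ltn_expl.
Qed.

Lemma escape a y t C : valid a y -> y < t ->
  exists N, forall m, (N <= m)%N -> C <= height a m t.
Proof.
move=> vy yt; have [N NC] := gap_large a y t C vy yt; exists N => m Nm.
by have := NC m Nm; have := vy m; lra.
Qed.

Lemma height_add a m N t :
  height (iter N shift a) m (height a N t) = height a (m + N) t.
Proof. by elim: m => //= m ->; rewrite iter_shift addnC. Qed.

Lemma valid_iter a m t : valid a t -> valid (iter m shift a) (height a m t).
Proof. by move=> va j; rewrite height_add. Qed.

(** A point on a side wall would have its whole orbit on side walls, in tubes just born; the heights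
    would then stay at most 1 and could not escape. *)
Lemma off_wall a y t i : valid a y -> y < t -> `|trace a i t| < 1.
Proof.
move=> vy yt; rewrite lt_neqAle ler_norml trace_ge trace_le !andbT.
apply/eqP => tr1; have vt := valid_mono _ _ _ (ltW yt) vy.
have step m : `|trace (iter m shift a) i (height a m t)| = 1 ->
    `|trace (iter m.+1 shift a) i (height a m.+1 t)| = 1 /\ height a m.+1 t <= 1.
  rewrite trace_iter => h.
  have h0 : birth (a m) < 2 * expR (2 * height a m t).
    by rewrite -climb_gt0; exact: (height_pos a m.+1 y).
  have [||||-> hb] := cell_wall _ _ _ _ _ _ _ h.
  - exact: vt.
  - by apply: le_lt_trans h0; exact: birth_ge.
  - exact: trace_ge.
  - exact: trace_le.
  (* With B the birth value, b(t) <= |c| + 1 <= B + 2 <= 2B, so the next height is at most 1. *)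
  split=> //=; have b2 := @birth_ge2 R n (a m).
  rewrite /climb lerBlDr ler_pdivrMr ?birth_gt0//.
  by have := @birth_ge R n (a m) i; lra.
have all1 m : `|trace (iter m shift a) i (height a m t)| = 1.
  by elim: m => // m IH; case: (step m IH).
have [N NC] := escape a y t 2 vy yt.
by have := NC N.+1 (leqnSn N); have [] := step N (all1 N); lra.
Qed.

(** Symbols are read off one at a time: the next iterate along [a] is off the walls, so
    [cell_symbol] gives the symbol and injectivity of the cell maps gives the next positions. *)
Lemma address_unique a b y t : valid a y -> y < t -> valid b t ->
  (forall i, trace a i t = trace b i t) -> a = b.
Proof.
move=> vy yt vb tr.
have step m : height a m t = height b m t ->
    (forall i, trace (iter m shift a) i (height a m t) =
      trace (iter m shift b) i (height b m t)) ->
    a m = b m /\ (forall i, trace (iter m.+1 shift a) i (height a m.+1 t) =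
      trace (iter m.+1 shift b) i (height b m.+1 t)).
  move=> hh hm.
  have h0 : birth (a m) < 2 * expR (2 * height a m t).
    by rewrite -climb_gt0; exact: (height_pos a m.+1 y).
  have lt i : barrier (center (a m) i - 1) (height a m t) <
      barrier (center (a m) i + 1) (height a m t).
    apply: barrier_lt; first exact: (ltW (height_pos a m y t vy yt)).
    by apply: le_lt_trans h0; exact: birth_ge.
  have wall i : `|trace (iter m.+1 shift a) i (height a m.+1 t)| < 1.
    apply: (off_wall _ (height a m.+1 y)).
      exact: valid_iter.
    by have := height_gap a m.+1 t y vy (ltW yt);
      have : 0 < 2 ^+ m.+1 * (t - y); [rewrite mulr_gt0 ?exprn_gt0// subr_gt0 | lra].
  have ab : a m = b m.
    apply/ffunP => i; have := wall i; rewrite ltr_norml => /andP[w1 w2].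
    apply: (cell_symbol _ _ _ _ _ (lt i) w1 w2 (trace_ge (iter m.+1 shift b) i
       (height b m.+1 t)) (trace_le _ _ _)).
    by have := hm i; rewrite (trace_iter a i m) (trace_iter b i m) hh.
  split=> // i; have := hm i; rewrite (trace_iter a i m) (trace_iter b i m) -hh -ab.
  by apply: cell_inj; exact: lt.
have all m : height a m t = height b m t /\
    (forall i, trace (iter m shift a) i (height a m t) =
      trace (iter m shift b) i (height b m t)).
  elim: m => // m [hh hm]; have [ab ?] := step m hh hm; split=> //=.
  by rewrite hh ab.
by apply/funext => m; have [hh hm] := all m; case: (step m hh hm).
Qed.

Lemma address_exists (x : 'I_n -> R) t : 0 <= t -> (forall i, -1 <= x i <= 1) ->
  exists2 a, valid a t & forall i, trace a i t = x i.
Proof.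
move=> t0 x1; pose state := (('I_n -> R) * R)%type.
pose ok (p : state) := 0 <= p.2 /\ forall i, -1 <= p.1 i <= 1.
(* The requirement is vacuous outside [ok], so that choice yields a total function. *)
pose next (p : state) (q : symbol * ('I_n -> R)) := ok p ->
  ok (q.2, climb q.1 p.2) /\ forall i, p.1 i = cell (center q.1 i) p.2 (q.2 i).
have /choice[f fP] : forall p, exists q, next p q.
  move=> p; have [okp|nokp] := pselect (ok p); last first.
    by exists ([ffun=> 0], fun=> 0) => /nokp.
  have [p0 p1] := okp.
  have /choice[g gP] : forall i, exists kv : int * R,
      [/\ `|2 * kv.1%:~R| - 1 <= 2 * expR (2 * p.2), -1 <= kv.2 <= 1
        & p.1 i = cell (2 * kv.1%:~R) p.2 kv.2].
    move=> i; have /andP[xi1 xi2] := p1 i.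
    have [k [v [h1 h2 h3 h4]]] := cell_surj _ _ p0 xi1 xi2.
    by exists (k, v); split=> //=; rewrite h2 h3.
  exists ([ffun i => (g i).1], fun i => (g i).2) => _; split=> [|i /=].
    split=> /= [|i]; last by have [] := gP i.
    rewrite climb_ge0; apply: birth_le => [|i].
      by have := @expR_ge1Dx R (2 * p.2); lra.
    by rewrite /center ffunE; have [] := gP i.
  by rewrite /center ffunE; have [] := gP i.
pose st := fix st m : state :=
  if m is m'.+1 then ((f (st m')).2, climb (f (st m')).1 (st m').2) else (x, t).
pose a m := (f (st m)).1.
have okst m : ok (st m).
  by elim: m => [|m IH]; [split | have [] := fP _ IH].
have ha m : height a m t = (st m).2 by elim: m => //= m ->.
exists a => [m|i]; first by rewrite ha; case: (okst m).
(* The chosen positions form a bounded solution of the recursion. *)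
apply/esym/(@trace_unique _ _ a i t (fun m => (st m).1 i)) => m.
  by case: (okst m).
by rewrite ha; have [_ ->] := fP _ (okst m).
Qed.

(* [birth] is an exponential of the height of birth, so the tubes entered at height [h] were
   born below height about [d * h / 2]. *)
Definition tame (M d : R) a t :=
  forall m, M <= height a m t /\ birth (a m) <= expR (d * height a m t).

(** Validity at [y] bounds each birth by an exponential of the lower height, which becomes
    negligible against the upper height as the gap grows. *)
Lemma eventually_tame M d a y t : 0 < d -> valid a y -> y < t ->
  exists N, tame M d (iter N shift a) (height a N t).
Proof.
move=> d0 vy yt; have [N1 H1] := escape a y t (Num.max M 1) vy yt.
have [N2 H2] := gap_large a y t (4 / d) vy yt.
(* The extra step lets the gap at index [j] control the ratio of the heights at index [j.+1]. *)
exists (N1 + N2).+1 => m; rewrite height_add iter_shift.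
rewrite (addnC _ m) addnS; move e : (m + (N1 + N2))%N => j.
have j1 : (N1 <= j)%N by rewrite -e addnCA leq_addr.
have j2 : (N2 <= j)%N by rewrite -e addnA leq_addl.
have := H1 j.+1 (leqW j1); rewrite ge_max => /andP[hM h1]; split=> //.
have : 0 <= height a j.+2 y by exact: vy.
rewrite [height a j.+2 y]/= climb_ge0 => /le_trans; apply.
have : (2 : R) <= expR 1 by have := @expR_ge1Dx R 1; lra.
set hy := climb _ (height a j y).
(* The factor 2 is absorbed into exp(1), which leaves 1 + 2 hy <= d hx; this follows from 4 (hy + 1)
   <= d (hx + 1) and hx >= 1. *)
move=> e1; apply: le_trans (_ : expR 1 * expR (2 * hy) <= _).
  by rewrite ler_pM2r// expR_gt0.
rewrite -expRD ler_expR.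
have hr := climb_ratio (a j) (height a j t) (height a j y).
have D := H2 j j2; set E := expR _ in hr.
have E1 : 4 / d <= E.
  apply: le_trans (expR_ge1Dx _); move: D; have : 0 < 4 / d by rewrite divr_gt0.
  lra.
have {}E1 : 4 <= d * E by rewrite mulrC -ler_pdivrMr.
have hy0 : 0 <= hy by have := vy j.+1.
rewrite -/hy in hr; rewrite /= in h1 *; set hx := climb _ _ in hr h1 *.
have : (hy + 1) * 4 <= d * (hx + 1) by rewrite hr; nra.
by nra.
Qed.

End AbstractHairs.

(** * Covers and null sets *)

Section Covers.
Context {R : realType} {d : nat}.
Local Notation V := 'rV[R]_d.
Implicit Types (A B : set V) (s c e L : R).

(* Diameters are measured in the max norm: only bounded factors are lost. *)
Definition coverable s A c := exists (U : nat -> set V) (r : nat -> R),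
  [/\ A `<=` \bigcup_j U j, forall j x y, U j x -> U j y -> `|x - y| <= r j,
      forall j, 0 <= r j & (\sum_(0 <= j <oo) (r j `^ s)%:E <= c%:E)%E].

Definition null s A := forall e, 0 < e -> coverable s A e.

Lemma coverable_le s A c c' : c <= c' -> coverable s A c -> coverable s A c'.
Proof.
move=> cc' [U [r [? ? ? h]]]; exists U, r; split=> //.
by apply: le_trans h _; rewrite lee_fin.
Qed.

Lemma coverable_sub s A B c : A `<=` B -> coverable s B c -> coverable s A c.
Proof. by move=> AB [U [r [? ? ? ?]]]; exists U, r; split=> //; exact: subset_trans AB _. Qed.

Lemma coverable_bigcup s (I : countType) (A : I -> set V) (c : I -> R) (C : R) :
  s != 0 -> (forall i, coverable s (A i) (c i)) ->
  (\esum_(i in [set: I]) (c i)%:E <= C%:E)%E -> coverable s (\bigcup_i A i) C.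
Proof.
move=> s0 /choice[U /choice[r Ur]] cC.
(* Numbers that code no pair get the empty set with bound 0, which costs nothing because
   [s != 0]. *)
pose U' j := if pickle_inv j is Some p then U p.1 p.2 else set0.
pose r' j := if pickle_inv j is Some p then r p.1 p.2 else 0.
exists U', r'; split=> [x [i _ Ax]|j|j|].
- have [+ _ _ _] := Ur i => /(_ x Ax)[j _ Ux].
  by exists (pickle (i, j)) => //; rewrite /U' pickleK_inv.
- rewrite /U' /r'; case: pickle_inv => [[i l]|]//= x y.
  by have [_ + _ _] := Ur i; exact.
- by rewrite /r'; case: pickle_inv => [[i l]|]//=; have [_ _ + _] := Ur i; exact.
- rewrite nneseries_esumT; last by move=> j; rewrite lee_fin powR_ge0.
  have -> : (\esum_(j in [set: nat]) (r' j `^ s)%:E =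
      \esum_(j in [set pickle p | p in [set: I * nat]]) (r' j `^ s)%:E)%E.
    rewrite [RHS]esum_mkcond; apply: eq_esum => j _; case: ifPn => //.
    rewrite notin_setE /r' /=; case e : (pickle_inv j) => [p|] np.
      by case: np; exists p => //; have := @pickle_invK (I * nat)%type j; rewrite e.
    by rewrite powR0.
  rewrite esum_image; last by move=> p q _ _ /(pcan_inj pickleK_inv).
  under eq_esum do rewrite /r' pickleK_inv.
  have -> : [set: I * nat] = [set: I] `*`` (fun=> [set: nat]).
    by apply/seteqP; split=> // -[].
  rewrite -(@esum_esum _ _ _ _ (fun=> setT) (fun i j => (r i j `^ s)%:E)); last first.
    by move=> i j _ _; rewrite lee_fin powR_ge0.
  apply: le_trans cC; apply: le_esum => i _.
  rewrite -nneseries_esumT; last by move=> j; rewrite lee_fin powR_ge0.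
  by have [_ _ _ +] := Ur i.
Qed.

Lemma coverable_finite s (I : finType) (A : I -> set V) c :
  s != 0 -> 0 <= c -> (forall i, coverable s (A i) c) ->
  coverable s (\bigcup_i A i) (#|I|%:R * c).
Proof.
move=> s0 c0 Ac; apply: (@coverable_bigcup _ _ _ (fun=> c)) => //.
rewrite esum_fset; [|exact: finite_finset|by move=> i _; rewrite lee_fin].
rewrite fsbig_finite; last exact: finite_finset.
rewrite sumEFin lee_fin big_const_seq iter_addr_0 count_predT -[leLHS]mulr_natl.
rewrite ler_wpM2r// ler_nat.
set S := fset_set _; have /card_uniqP <- := finmap.fset_uniq S.
exact: max_card.
Qed.

Lemma null_bigcup s (I : countType) (A : I -> set V) : s != 0 ->
  (forall i, null s (A i)) -> null s (\bigcup_i A i).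
Proof.
move=> s0 An e e0.
pose c (i : I) := e / (2 ^ (pickle i).+1)%:R.
apply: (@coverable_bigcup _ _ _ c) => // [i|].
  by apply: An; rewrite divr_gt0// ltr0n expn_gt0.
apply: le_trans (epsilon_trick0 xpredT (ltW e0)).
rewrite nneseries_esumT; last first.
  by move=> j; rewrite lee_fin divr_ge0// ltW.
rewrite -(esum_image setT pickle (fun j => (e / (2 ^ j.+1)%:R)%:E)); last first.
  by move=> p q _ _ /(pcan_inj pickleK_inv).
rewrite esum_mkcond; apply: le_esum => j _; case: ifPn => // _.
by rewrite lee_fin divr_ge0// ltW.
Qed.

(** A cover of [B] is pulled back along [rho], whose inverse is Lipschitz. A relation is used
    because a point may have several addresses, hence several images. *)
Lemma coverable_lip s A B (rho : V -> V -> Prop) L c : 0 <= L ->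
  (forall x, A x -> exists2 x', B x' & rho x x') ->
  (forall x y x' y', rho x x' -> rho y y' -> `|x - y| <= L * `|x' - y'|) ->
  coverable s B c -> coverable s A (L `^ s * c).
Proof.
move=> L0 AB rhoL [U [r [BU Ur r0 rc]]].
exists (fun j => [set x | exists2 x', U j x' & rho x x']), (fun j => L * r j).
split=> [x /AB[x' Bx' xx']|j x y [x' Ux' xx'] [y' Uy' yy']|j|].
- by have [j _ Ux'] := BU _ Bx'; exists j => //; exists x'.
- by apply: le_trans (rhoL _ _ _ _ xx' yy') _; rewrite ler_wpM2l//; exact: Ur.
- by rewrite mulr_ge0.
- under eq_eseriesr do rewrite powRM// EFinM.
  rewrite nneseriesZl; last by move=> j _; rewrite lee_fin powR_ge0.
  by rewrite EFinM lee_wpmul2l// lee_fin powR_ge0.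
Qed.

Lemma null_lip s A B (rho : V -> V -> Prop) L : 0 < L ->
  (forall x, A x -> exists2 x', B x' & rho x x') ->
  (forall x y x' y', rho x x' -> rho y y' -> `|x - y| <= L * `|x' - y'|) ->
  null s B -> null s A.
Proof.
move=> L0 AB rhoL Bn e e0; have Ls : 0 < L `^ s by rewrite powR_gt0.
have := coverable_lip _ _ _ _ _ _ (ltW L0) AB rhoL (Bn (e / L `^ s) (divr_gt0 e0 Ls)).
by rewrite mulrC divfK ?gt_eqF.
Qed.

Lemma null_sub s A B : A `<=` B -> null s B -> null s A.
Proof. by move=> AB Bn e e0; apply: coverable_sub AB (Bn e e0). Qed.

(** * Comparison with the Euclidean Hausdorff measure *)

Lemma enorm_le (x : V) : enorm x <= (Num.sqrt d%:R + 1) * `|x|.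
Proof.
apply: le_trans (_ : Num.sqrt d%:R * `|x| <= _); last by rewrite ler_wpM2r// lerDl.
rewrite -[`|x|]ger0_norm// -sqrtr_sqr -sqrtrM// /enorm ler_wsqrtr//.
rewrite mulr_natl -[X in _ *+ X]card_ord -sumr_const; apply: ler_sum => i _.
rewrite -real_normK ?num_real// -[leRHS]real_normK ?num_real// normr_id.
rewrite lerXn2r ?nnegrE// [leRHS]mx_normrE.
exact: (le_bigmax _ (fun ij : 'I_1 * 'I_d => `|x ij.1 ij.2|) (ord0, i)).
Qed.

Lemma coord_le_enorm (x : V) j : `|x ord0 j| <= enorm x.
Proof.
rewrite -sqrtr_sqr /enorm ler_wsqrtr// (bigD1 j)//= lerDl.
by apply: sumr_ge0 => i _; exact: sqr_ge0.
Qed.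

Lemma ediam_ge0 (U : set V) x : U x -> (0 <= ediam U)%E.
Proof.
move=> Ux; apply: ereal_sup_ubound; exists x => //; exists x => //.
rewrite /Defs.edist subrr /enorm big1 ?sqrtr0// => i _.
by rewrite mxE expr0n.
Qed.

Lemma hcost_ge0 s (U : set V) : (0 <= hcost s U)%E.
Proof.
rewrite /hcost; case: asboolP => // _; case: ediam => //= r.
by rewrite lee_fin powR_ge0.
Qed.

Lemma hcost_le s (U : set V) r : 0 <= s -> 0 <= r -> (ediam U <= r%:E)%E ->
  (hcost s U <= (r `^ s)%:E)%E.
Proof.
move=> s0 r0; rewrite /hcost; case: asboolP => [_|/eqP/set0P[x Ux]].
  by rewrite lee_fin powR_ge0.
have := ediam_ge0 U x Ux; case: ediam => //= q; rewrite !lee_fin => q0 qr.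
by apply: ge0_ler_powR; rewrite ?nnegrE.
Qed.

(** Nullity carries no mesh condition: for [s > 0] a small total cost already forces every piece to
    be small. *)
Lemma null_hausdorff s A : 0 < s -> null s A -> hausdorff_measure s A = 0%E.
Proof.
move=> s0 An; set D := Num.sqrt (d%:R : R) + 1.
have D0 : 0 < D by rewrite ltr_wpDl.
have Ds0 : 0 < D `^ s by rewrite powR_gt0.
suff content0 delta : 0 < delta -> hausdorff_content s delta A = 0%E.
  apply/le_anti/andP; split.
    by apply: ge_ereal_sup => _ [delta /= delta0 <-]; rewrite content0.
  by apply: ereal_sup_ubound; exists 1 => //=; exact: content0.
move=> delta0; apply/le_anti/andP; split; last first.
  apply: le_ereal_inf_tmp => _ [U _ <-]; apply: nneseries_ge0 => j _ _.
  exact: hcost_ge0.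
apply/lee_addgt0Pr => e e0; rewrite add0e.
have m0 : 0 < Num.min e (delta `^ s) by rewrite lt_min e0 powR_gt0.
have [U [r [AU Ur r0 rc]]] := An (Num.min e (delta `^ s) / D `^ s) (divr_gt0 m0 Ds0).
have sumDr : (\sum_(0 <= j <oo) ((D * r j) `^ s)%:E <= (Num.min e (delta `^ s))%:E)%E.
  under eq_eseriesr do rewrite (powRM _ (ltW D0))// EFinM.
  rewrite nneseriesZl; last by move=> j _; rewrite lee_fin powR_ge0.
  apply: le_trans (lee_wpmul2l _ rc) _; first by rewrite lee_fin ltW.
  by rewrite -EFinM mulrC divfK ?gt_eqF.
have diamU j : (ediam (U j) <= (D * r j)%:E)%E.
  apply: ge_ereal_sup => _ [x Ux [y Uy <-]]; rewrite lee_fin.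
  by apply: le_trans (enorm_le _) _; rewrite ler_pM2l//; exact: Ur.
have Dr0 j : 0 <= D * r j by rewrite mulr_ge0// ltW.
have Dr_delta j : D * r j <= delta.
  rewrite leNgt; apply/negP => h.
  have : delta `^ s < (D * r j) `^ s by apply: gt0_ltr_powR; rewrite ?nnegrE// ltW.
  apply/negP; rewrite -leNgt -lee_fin.
  apply: (@le_trans _ _ (Num.min e (delta `^ s))%:E); last by rewrite lee_fin ge_min lexx orbT.
  apply: le_trans sumDr; apply: le_trans (nneseries_lim_ge j.+1 _); last first.
    by move=> i _ _; rewrite lee_fin powR_ge0.
  rewrite big_nat_recr//= leeDr//; apply: sume_ge0 => i _.
  by rewrite lee_fin powR_ge0.
apply: ge_ereal_inf; exists (\sum_(0 <= j <oo) hcost s (U j))%E.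
  exists U => //; split=> // j; apply: le_trans (diamU j) _.
  by rewrite lee_fin.
apply: (@le_trans _ _ (Num.min e (delta `^ s))%:E); last by rewrite lee_fin ge_min lexx.
apply: le_trans sumDr; apply: lee_nneseries => [j _ _|j _]; first exact: hcost_ge0.
by apply: hcost_le => //; exact: ltW.
Qed.

Lemma hausdorff_projection s A (j : 'I_d) (l : R) : 0 <= s -> s < 1 ->
  (forall h, l <= h <= l + 1 -> exists2 x, A x & x ord0 j = h) ->
  hausdorff_measure s A <> 0%E.
Proof.
move=> s0 s1 proj HA.
have : (hausdorff_content s 1 A <= 0)%E.
  by rewrite -HA; apply: ereal_sup_ubound; exists 1 => /=.
(* The bound 1/2 offsets the factor 2 between the diameter of [U i] and the length of [J i]
   below. *)
have h2 : (0 < (2^-1 : R)%:E)%E by rewrite lte_fin.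
move=> /le_lt_trans /(_ h2) /ereal_inf_lt[_ [U [AU Ud] <-]] sumU.
have /choice[p pP] : forall i, exists x : V, U i !=set0 -> U i x.
  by move=> i; have [[x Ux]|n0] := pselect (U i !=set0); [exists x | exists 0].
pose D i := fine (ediam (U i)).
have UD i : U i !=set0 -> 0 <= D i <= 1 /\ ediam (U i) = (D i)%:E.
  move=> /pP Up; have := ediam_ge0 _ _ Up; have := Ud i; rewrite /D.
  by case: ediam => //= q; rewrite !lee_fin => -> ->.
pose J i := if `[< U i = set0 >] then set0
  else [set` `[p i ord0 j - D i, p i ord0 j + D i]] : set R.
have mJ i : measurable (J i) by rewrite /J; case: ifP.
have cov : [set` `[l, l + 1]] `<=` \bigcup_i J i.
  move=> h /=; rewrite in_itv /= => /proj[x /AU[i _ Ux] <-]; exists i => //.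
  rewrite /J; case: asboolP => [U0|_]; first by move: Ux; rewrite U0.
  have Un : U i !=set0 by exists x.
  rewrite /= in_itv /= -ler_distl.
  have := coord_le_enorm (x - p i) j; rewrite !mxE => /le_trans; apply.
  have [_ e] := UD i Un; rewrite -lee_fin -e.
  by apply: ereal_sup_ubound; exists x => //; exists (p i) => //; exact: pP.
have mI : measurable ([set` `[l, l + 1]] : set R) by [].
have len1 : lebesgue_measure ([set` `[l, l + 1]] : set R) = 1%:E.
  by rewrite lebesgue_measure_itv /= lte_fin ltrDl ltr01 -EFinD addrAC subrr add0r.
have lenJ i : (lebesgue_measure (J i) <= 2%:E * hcost s (U i))%E.
  rewrite /J /hcost; case: asboolP => [_|/eqP/set0P Un]; first by rewrite measure0 mule0.
  have [/andP[D0 D1] ->] := UD i Un; rewrite lebesgue_measure_itv /= lte_fin.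
  case: ifPn => [_|_]; last by rewrite -EFinM lee_fin mulr_ge0// powR_ge0.
  rewrite -EFinB -EFinM lee_fin.
  have : D i <= D i `^ s.
    have := D0; rewrite le_eqVlt => /orP[/eqP <-|Dp]; first exact: powR_ge0.
    by apply: ger1_powR; [rewrite Dp D1 | exact: ltW].
  lra.
have : (1%:E <= \sum_(0 <= i <oo) (2%:E * hcost s (U i)) :> \bar R)%E.
  rewrite -len1; apply: le_trans (measure_sigma_subadditive lebesgue_measure mJ mI cov) _.
  by apply: lee_nneseries => [i _ _|i _]; [exact: measure_ge0 | exact: lenJ].
rewrite nneseriesZl; last by move=> i _; exact: hcost_ge0.
apply/negP; rewrite -ltNge muleC -lte_pdivlMr// mul1e; exact: sumU.
Qed.

End Covers.

(** * Dimension at most one *)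

Section TameSets.
Context {R : realType} {n : nat}.
Local Notation V := 'rV[R]_n.+1.
Local Notation symbol := {ffun 'I_n -> int}.
Local Notation address := (nat -> symbol).
Implicit Types (k : symbol) (a b : address) (t h s M d : R) (i : 'I_n) (q m N : nat).

Definition point (u : 'I_n -> R) h : V :=
  \row_j (if unlift ord0 j is Some i then u i else h).

Lemma point_height u h : point u h ord0 ord0 = h.
Proof. by rewrite mxE unlift_none. Qed.

Lemma point_side u h i : point u h ord0 (lift ord0 i) = u i.
Proof. by rewrite mxE liftK. Qed.

Lemma point_eta (x : V) : point (fun i => x ord0 (lift ord0 i)) (x ord0 ord0) = x.
Proof.
apply/rowP => j; rewrite mxE; case: unliftP => [i ->|->] //.
Qed.

Lemma norm_point_le (x y : V) (c : R) : 0 <= c -> `|x ord0 ord0 - y ord0 ord0| <= c ->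
  (forall i, `|x ord0 (lift ord0 i) - y ord0 (lift ord0 i)| <= c) -> `|x - y| <= c.
Proof.
move=> c0 h0 hi; rewrite [leLHS]mx_normrE; apply: bigmax_le => // -[i0 j] _ /=.
by rewrite (ord1 i0) !mxE; case: (unliftP ord0 j) => [i ->|->].
Qed.

Lemma coord_le_norm (x y : V) j : `|x ord0 j - y ord0 j| <= `|x - y|.
Proof.
rewrite [leRHS]mx_normrE.
have := le_bigmax 0 (fun ij : 'I_1 * 'I_n.+1 => `|(x - y) ij.1 ij.2|) (ord0, j).
by rewrite /= !mxE.
Qed.

Definition hairpt a t : V := point (fun i => trace a i t) t.

(** The derivative of [climb] is 2 (climb + 1), hence at least 2l where climb + 1 >= l; the second
    alternative says that [x] is outside that region. *)
Lemma climb_gap_ge k (l x y : R) : 0 <= l -> l <= climb k y + 1 ->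
  `|x - y| * (2 * l) <= `|climb k x - climb k y| \/ climb k x + 1 < l.
Proof.
move=> l0 ly; have [lx|lx] := leP l (climb k x + 1); [left | by right].
wlog yx : x y lx ly / y <= x.
  move=> W; have [yx|/ltW xy] := leP y x; first exact: W.
  by rewrite distrC (distrC (climb _ _)); exact: W.
rewrite !ger0_norm ?subr_ge0// ?climb_mono//.
have := climb_ratio k x y; have := @expR_ge1Dx R (2 * (x - y)); nra.
Qed.

(** An inverse branch contracts heights by 1/(2l). Sideways it costs the scale, at most 1/(2l), plus
    twice the height difference: 3/(2l) in all. *)
Lemma hairpt_lip a b t t' (l : R) : 0 <= t -> 0 < l -> a 0%N = b 0%N ->
  l <= climb (a 0%N) t + 1 -> l <= climb (b 0%N) t' + 1 ->
  `|hairpt a t - hairpt b t'| <= 2 / l *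
    `|hairpt (shift a) (climb (a 0%N) t) - hairpt (shift b) (climb (b 0%N) t')|.
Proof.
move=> t0 l0 ab lt lt'; set x' := hairpt (shift a) _; set y' := hairpt (shift b) _.
set D := `|x' - y'|; have D0 : 0 <= D by exact: normr_ge0.
have hD : `|climb (a 0%N) t - climb (a 0%N) t'| <= D.
  have <- : x' ord0 ord0 = climb (a 0%N) t by exact: point_height.
  have <- : y' ord0 ord0 = climb (a 0%N) t' by rewrite ab; exact: point_height.
  exact: coord_le_norm.
have sD i : `|trace (shift a) i (climb (a 0%N) t) -
    trace (shift b) i (climb (b 0%N) t')| <= D.
  rewrite -(point_side (fun i => trace (shift a) i _) (climb (a 0%N) t)).
  rewrite -(point_side (fun i => trace (shift b) i _) (climb (b 0%N) t')).
  exact: coord_le_norm.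
have lta : l <= climb (a 0%N) t' + 1 by rewrite ab.
have tt : `|t - t'| * (2 * l) <= D.
  have [h|] := @climb_gap_ge (a 0%N) l t t' (ltW l0) lta; last by lra.
  exact: le_trans hD.
have {}tt : `|t - t'| <= D / (2 * l) by rewrite ler_pdivlMr// mulr_gt0.
have e : D / (2 * l) = 2^-1 * (l^-1 * D) by rewrite invfM; ring.
have lD : 0 <= l^-1 * D by rewrite mulr_ge0// invr_ge0 ltW.
apply: norm_point_le => [||i]; rewrite ?point_height.
- by rewrite -mulrA mulr_ge0.
- by rewrite -mulrA; lra.
rewrite !point_side trace_rec [X in _ - X]trace_rec -ab.
apply: le_trans (cell_lip _ _ _ _ _ (trace_ge _ _ _) (trace_le _ _ _)) _.
have sc : scale t <= (2 * l)^-1.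
  have b2 := birth_ge2 (R := R) (a 0%N).
  rewrite scaleE// lef_pV2 ?posrE ?mulr_gt0// ?expR_gt0//.
  apply: le_trans (_ : birth (a 0%N) * l <= _); first by rewrite ler_pM2r.
  rewrite mulrC -ler_pdivlMr ?birth_gt0//.
  by move: lt; rewrite /climb subrK.
have : scale t * `|trace (shift a) i (climb (a 0%N) t) -
    trace (shift b) i (climb (a 0%N) t')| <= (2 * l)^-1 * D.
  by apply: ler_pM => //; [exact/ltW/scale_gt0 | rewrite {2}ab; exact: sD].
rewrite (mulrC _ D) e -mulrA; lra.
Qed.

(** The graph of the expanding map on the tube [k], restricted to heights with b(t)/B(k) >= l. *)
Definition descends k (l : R) (x x' : V) := exists a t,
  [/\ x = hairpt a t, x' = hairpt (shift a) (climb k t), a 0%N = k, 0 <= t &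
      l <= climb k t + 1].

Lemma descends_lip k (l : R) : 0 < l -> forall x y x' y',
  descends k l x x' -> descends k l y y' -> `|x - y| <= 2 / l * `|x' - y'|.
Proof.
move=> l0 x y x' y' [a [t [-> -> ak t0 lt]]] [b [t' [-> -> bk t0' lt']]].
by rewrite -{1}ak -bk; apply: hairpt_lip; rewrite ?ak ?bk.
Qed.

Definition slab M d q : set V := [set x | exists a t,
  [/\ x = hairpt a t, tame M d a t, q%:R <= t & t <= q%:R + 1]].

(** A lower bound for b(t)/B(k) on the tame slab [q]. *)
Definition width d q : R := expR (2 * q%:R - d * (q%:R + 1)).

Definition nsymbol d q : nat := Num.truncn (expR (d * (q%:R + 1)) : R).

Definition nheight q : nat := Num.truncn (expR (2 * (q%:R + 1)) : R).

(** Bounds the number of pairs of a symbol and an integer part of the next height that occur on the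
    tame slab [q]. *)
Definition nbranch d q : R := ((2 * nsymbol d q).+1 ^ n * (nheight q).+1)%:R.

Lemma symbol_small k d q t i : 0 <= d -> t <= q%:R + 1 -> birth k <= expR (d * t) ->
  (`|k i| <= nsymbol d q)%N.
Proof.
move=> d0 tq bk; rewrite /nsymbol truncn_ge_nat ?expR_ge0// natr_absz intr_norm.
have h1 := birth_ge (R := R) k i; have h2 := birth_ge2 (R := R) k.
apply: le_trans (_ : birth k <= _).
  by move: h1; rewrite /center normrM (@ger0_norm _ 2)//; lra.
by apply: le_trans bk _; rewrite ler_expR ler_wpM2l.
Qed.

(** The slab is split by its first symbol and the integer part of the next height; each piece is
    pulled back from a slab by a contracting inverse branch. *)
Lemma slab_step s M d q c : s != 0 -> 0 <= M -> 0 <= d -> 0 <= c ->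
  (forall q', coverable s (slab M d q') c) ->
  coverable s (slab M d q) (nbranch d q * ((2 / width d q) `^ s * c)).
Proof.
move=> s0 M0 d0 c0 IH; set B := nsymbol d q; set Q := nheight q.
have w0 : 0 < width d q by exact: expR_gt0.
pose I : finType := ({ffun 'I_n -> 'I_(2 * B).+1} * 'I_Q.+1)%type.
(* Labels in [-B, B] are stored as numbers in [0, 2B]. *)
pose sym (p : I) : symbol := [ffun i => (p.1 i : nat)%:Z - B%:Z].
pose A (p : I) : set V :=
  [set x | exists2 x', slab M d p.2 x' & descends (sym p) (width d q) x x'].
have -> : nbranch d q = #|I|%:R.
  by rewrite /nbranch card_prod card_ffun !card_ord.
apply: (@coverable_sub _ _ _ _ (\bigcup_p A p)); last first.
  apply: coverable_finite => // [|p]; first by rewrite mulr_ge0// powR_ge0.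
  apply: (@coverable_lip _ _ _ _ (slab M d p.2) (descends (sym p) (width d q))) => //.
  - by rewrite divr_ge0// ltW.
  - exact: descends_lip.
move=> _ [a [t [-> ta qt tq]]].
have [Mt bt] := ta 0%N; have [Mc bc] := ta 1%N; rewrite /= in Mt bt Mc bc.
set c1 := climb (a 0%N) t in Mc bc; have c10 : 0 <= c1 by apply: le_trans Mc.
have small i := symbol_small (a 0%N) d q t i d0 tq bt.
have c1Q : (Num.truncn c1 <= Q)%N.
  apply: le_truncn; rewrite /c1 /climb lerBlDr ler_pdivrMr ?birth_gt0//.
  have b2 := birth_ge2 (R := R) (a 0%N).
  have : expR (2 * t) <= expR (2 * (q%:R + 1)) by rewrite ler_expR; lra.
  by have := @expR_ge0 R (2 * t); nra.
pose p : I := ([ffun i => inord (absz (a 0%N i + B%:Z))], inord (Num.truncn c1)).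
have symp : sym p = a 0%N.
  apply/ffunP => i; have := small i; rewrite !ffunE -/B.
  move: (a 0%N i) => z zB; rewrite inordK; last by clear -zB; lia.
  by clear -zB; lia.
have p2 : p.2 = Num.truncn c1 :> nat by rewrite /= inordK.
exists p => //; exists (hairpt (shift a) c1).
  have /andP[q1 q2] := truncn_itv c10.
  exists (shift a), c1; rewrite p2; split=> //; last by rewrite -natr1 in q2; exact: ltW.
  by move=> m; rewrite -height_shift; exact: ta m.+1.
exists a, t; rewrite symp; split=> //; first exact: le_trans Mt.
rewrite /climb subrK ler_pdivlMr ?birth_gt0//.
apply: le_trans (_ : width d q * expR (d * (q%:R + 1)) <= _).
  rewrite ler_pM2l//; apply: le_trans bt _.
  by rewrite ler_expR ler_wpM2l.
rewrite /width -expRD subrK.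
have : expR (2 * q%:R) <= expR (2 * t) by rewrite ler_expR; lra.
by have := @expR_ge0 R (2 * t); lra.
Qed.

Lemma nbranch_small s : 1 < s -> exists d N0, 0 < d /\
  forall q, (N0 <= q)%N -> nbranch d q * (2 / width d q) `^ s <= 2^-1.
Proof.
move=> s1; have s0 : 0 < s by lra.
have ns : 0 < n%:R + s by rewrite ltr_wpDl.
(* With x = q + 1 the product has exponent (n + s) d x - 2 (s - 1) x up to constants; this choice of
   [d] leaves -(s - 1) x. *)
set d := (s - 1) / (n%:R + s).
have d0 : 0 < d by rewrite divr_gt0// subr_gt0.
pose C : R := 3 ^+ n * 2 * 2 `^ s * expR (2 * s).
have C0 : 0 < C by rewrite !mulr_gt0 ?exprn_gt0 ?powR_gt0 ?expR_gt0.
exists d, (Num.truncn (2 * C / (s - 1))).+1; split=> // q Nq.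
have qC : 2 * C <= (s - 1) * (q%:R + 1).
  rewrite [leRHS]mulrC -ler_pdivrMr ?subr_gt0//.
  apply/ltW; apply: lt_le_trans (truncnS_gt _) _.
  by rewrite natr1 ler_nat; apply: leqW.
set x : R := q%:R + 1 in qC *; have x0 : 0 <= x by rewrite addr_ge0.
have dx0 : 0 <= d * x by rewrite mulr_ge0// ltW.
have K1 : 1 <= expR (d * x) by have := @expR_ge1Dx R (d * x); lra.
have H1 : 1 <= expR (2 * x) by have := @expR_ge1Dx R (2 * x); lra.
have bK : ((2 * nsymbol d q).+1)%:R <= 3 * expR (d * x).
  have : (nsymbol d q)%:R <= expR (d * x) by rewrite truncn_le expR_ge0.
  by rewrite -natr1 natrM; lra.
have bH : ((nheight q).+1)%:R <= 2 * expR (2 * x).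
  have : (nheight q)%:R <= expR (2 * x) by rewrite truncn_le expR_ge0.
  by rewrite -natr1; lra.
have nb : nbranch d q <= (3 * expR (d * x)) ^+ n * (2 * expR (2 * x)).
  rewrite /nbranch natrM natrX ler_pM ?exprn_ge0//.
  by apply: lerXn2r; rewrite ?nnegrE ?ler0n ?mulr_ge0 ?expR_ge0.
apply: le_trans (ler_wpM2r (powR_ge0 _ _) nb) _.
have -> : (2 / width d q) `^ s = 2 `^ s * expR (- (2 * q%:R - d * x) * s).
  by rewrite powRM// ?invr_ge0 ?expR_ge0// expRM /width expRN.
have -> : (3 * expR (d * x)) ^+ n * (2 * expR (2 * x)) *
    (2 `^ s * expR (- (2 * q%:R - d * x) * s)) = C * expR (- ((s - 1) * x)).
  have -> : - ((s - 1) * x) = (d * x) * n%:R + 2 * x + (- (2 * q%:R - d * x) * s) - 2 * s.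
    have e : d * (n%:R + s) = s - 1 by rewrite divfK// gt_eqF.
    have -> : d * x * n%:R = d * (n%:R + s) * x - d * x * s by ring.
    by rewrite e /x; ring.
  rewrite !expRD expRM_natr exprMn /C expRN; field.
  by rewrite gt_eqF// expR_gt0.
rewrite expRN ler_pdivrMr ?expR_gt0//.
have := @expR_ge1Dx R ((s - 1) * x); lra.
Qed.

Lemma trace_dist a b t t' i : `|trace a i t - trace b i t'| <= 2.
Proof.
have := trace_ge a i t; have := trace_le a i t.
have := trace_ge b i t'; have := trace_le b i t'.
by rewrite ler_norml; lra.
Qed.

Lemma slab_coverable s M d q : s != 0 -> coverable s (slab M d q) (2 `^ s).
Proof.
move=> s0; exists (fun j => if j == 0%N then slab M d q else set0).
exists (fun j => if j == 0%N then 2 else 0).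
split=> [x|[|j] x y|[|j]|]//; first by exists 0%N.
  move=> [a [t [-> _ t1 t2]]] [b [t' [-> _ t1' t2']]].
  apply: norm_point_le => // [|i].
    by rewrite !point_height ler_norml; lra.
  by rewrite !point_side trace_dist.
rewrite nneseries_esumT; last by move=> j; rewrite lee_fin powR_ge0.
rewrite [leLHS](_ : _ = \esum_(j in [set 0%N]) (2 `^ s)%:E)%E.
  by rewrite esum_set1// lee_fin powR_ge0.
rewrite [RHS]esum_mkcond; apply: eq_esum => -[|j] _.
  by rewrite mem_set.
by rewrite memNset//= powR0.
Qed.

(** A bound valid for all slabs at once is improved by the factor 1/2 in each round of
    [slab_step]. *)
Lemma slab_null s : 1 < s -> exists M d, [/\ 0 <= M, 0 < d & forall q, null s (slab M d q)].
Proof.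
move=> s1; have s0 : s != 0 by rewrite gt_eqF//; lra.
have [d [N0 [d0 small]]] := nbranch_small s s1.
pose M : R := N0%:R + 1; exists M, d; split=> //; first by rewrite addr_ge0.
have cov m q : coverable s (slab M d q) (2 `^ s * 2^-1 ^+ m).
  elim: m q => [|m IH] q; first by rewrite mulr1; exact: slab_coverable.
  have c0 : 0 <= 2 `^ s * 2^-1 ^+ m :> R by rewrite mulr_ge0 ?powR_ge0 ?exprn_ge0.
  have large j : (N0 <= j)%N -> coverable s (slab M d j) (2 `^ s * 2^-1 ^+ m.+1).
    move=> Nj; apply: coverable_le (slab_step s M d j _ s0 _ (ltW d0) c0 IH).
      by rewrite exprS mulrA [leRHS]mulrCA ler_wpM2r//; exact: small.
    by rewrite addr_ge0.
  have [Nq|qN] := leqP N0 q; first exact: large.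
  (* For q < N0 the slab is empty, as tame heights are at least M = N0 + 1. *)
  apply: coverable_sub (large N0 (leqnn _)) => _ [a [t [-> ta _ tq]]].
  have [/= Mt _] := ta 0%N; have : (q.+1%:R : R) <= N0%:R by rewrite ler_nat.
  by rewrite -natr1; move: Mt; rewrite /M; lra.
move=> q e e0; have [m me] := geometric_small (e / 2 `^ s * 2)
  (mulr_gt0 (divr_gt0 e0 (powR_gt0 s (ltr0n R 2))) (ltr0n R 2)).
apply: coverable_le (cov m q).
by rewrite mulrC -ler_pdivlMr ?powR_gt0//; lra.
Qed.

Definition tail M d N : set V := [set x | exists a t,
  [/\ x = hairpt a t, valid a t & tame M d (iter N shift a) (height a N t)]].

(** Each step back to an earlier height uses countably many inverse branches, all Lipschitz with
    constant 2. *)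
Lemma tail_null s M d N : s != 0 -> 0 <= M -> (forall q, null s (slab M d q)) ->
  null s (tail M d N).
Proof.
move=> s0 M0 slab0; elim: N => [|N IH].
  apply: (@null_sub _ _ _ _ (\bigcup_q slab M d q)); last exact: null_bigcup.
  move=> _ [a [t [-> va ta]]]; have t0 := valid_ge0 a t va.
  exists (Num.truncn t) => //; exists a, t; have /andP[h1 h2] := truncn_itv t0.
  by split=> //; rewrite natr1 ltW.
pose A (k : symbol) := [set x | exists2 x', tail M d N x' & descends k 1 x x'].
apply: (@null_sub _ _ _ _ (\bigcup_k A k)); last first.
  apply: null_bigcup => // k.
  apply: (@null_lip _ _ _ _ (tail M d N) (descends k 1) (2 / 1)) => //.
  exact: descends_lip.
move=> _ [a [t [-> va ta]]]; exists (a 0%N) => //.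
exists (hairpt (shift a) (climb (a 0%N) t)).
  exists (shift a), (climb (a 0%N) t); split=> //; first exact: valid_shift.
  by rewrite -iterSr -height_shift.
exists a, t; split=> //; first exact: valid_ge0 va.
by rewrite lerDr; exact: (va 1%N).
Qed.

Definition hair_interiors : set V :=
  [set x | exists a y t, [/\ x = hairpt a t, valid a y & y < t]].

Lemma hair_interiors_null s : 1 < s -> null s hair_interiors.
Proof.
move=> s1; have s0 : s != 0 by rewrite gt_eqF//; lra.
have [M [d [M0 d0 slab0]]] := slab_null s s1.
apply: (@null_sub _ _ _ _ (\bigcup_N tail M d N)); last first.
  by apply: null_bigcup => // N; exact: tail_null.
move=> _ [a [y [t [-> vy yt]]]].
have [N tN] := eventually_tame M d a y t d0 vy yt.
by exists N => //; exists a, t; split=> //; exact: valid_mono (ltW yt) vy.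
Qed.

End TameSets.

(** * Filling the space with hairs *)

Section Hairs.
Context {R : realType} {n : nat}.
Local Notation V := 'rV[R]_n.+1.
Local Notation symbol := {ffun 'I_n -> int}.
Local Notation address := (nat -> symbol).
Implicit Types (j : symbol) (b : bool) (a : address) (x y : V) (s t : R).

Definition chart j b x : V :=
  point (fun i => 2 * (j i)%:~R + x ord0 (lift ord0 i)) ((-1) ^+ b * x ord0 ord0).

Lemma chart_dist j b x y : `|chart j b x - chart j b y| <= `|x - y|.
Proof.
apply: norm_point_le => // [|i].
  rewrite !point_height -mulrBr normrM normrX normrN1 expr1n mul1r.
  exact: coord_le_norm.
by rewrite !point_side opprD addrACA subrr add0r; exact: coord_le_norm.
Qed.

(** Addresses without any valid height carry no hair and are excluded. *)
Definition index := {p : symbol * bool * address | exists t : R, valid p.2 t}.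

Definition hair (p : index) t : V :=
  let: (j, b, a) := sval p in chart j b (hairpt a (start a + t)).

Lemma hair_continuous (p : index) : continuous (hair p).
Proof.
case: p => [[[j b] a] va] t; apply/cvgrPdist_le => e e0.
have shift_cvg : (start a + s : R) @[s --> t] --> start a + t.
  by apply: cvgD; [exact: cvg_cst | exact: cvg_id].
have close : \forall s \near t, forall i,
    `|trace a i (start a + t) - trace a i (start a + s)| <= e.
  apply: (@filter_forall _ _
    (fun i s => `|trace a i (start a + t) - trace a i (start a + s)| <= e) (nbhs t) _) => i.
  have /cvgrPdist_le h : trace a i (start a + s) @[s --> t] --> trace a i (start a + t).
    by apply: continuous_cvg; [exact: trace_continuous | exact: shift_cvg].
  exact: h.
have close0 : \forall s \near t, `|start a + t - (start a + s)| <= e.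
  by move/cvgrPdist_le : shift_cvg => h; exact: h.
apply: filterS2 close close0 => s h h0; rewrite /hair /=.
apply: le_trans (chart_dist _ _ _ _) _; apply: norm_point_le; first exact: ltW.
  by rewrite !point_height.
by move=> i; rewrite !point_side.
Qed.

(** The height itself parametrizes a hair, which gives injectivity and divergence at once. *)
Lemma hair_height (p : index) t : 0 <= t ->
  `|hair p t ord0 ord0| = start (sval p).2 + t.
Proof.
case: p => [[[j b] a] [s va]] t0; rewrite /hair /= /chart !point_height.
rewrite normrM normrX normrN1 expr1n mul1r ger0_norm//.
by rewrite addr_ge0//; exact: (valid_ge0 _ _ (start_valid _ _ va)).
Qed.

Lemma hair_is_hair (p : index) : hair_param (hair p).
Proof.
split; first exact/continuous_subspaceT/hair_continuous.
split=> [s t s0 t0 e|M].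
  by have := hair_height p s s0; rewrite e hair_height// => /addrI.
exists (`|M| + 1) => t Mt; have t0 : 0 <= t by have := normr_ge0 M; lra.
apply: lt_le_trans (coord_le_enorm _ ord0); rewrite hair_height//.
have : 0 <= start (sval p).2 :> R.
  by case: p => -[q a] /= [s va]; exact: (valid_ge0 _ _ (start_valid _ _ va)).
by have := ler_norm M; lra.
Qed.

Lemma hairs_cover x : exists p t, 0 <= t /\ hair p t = x.
Proof.
(* Half of an even integer within distance 1 of the side coordinate. *)
pose j : symbol := [ffun i => Num.floor ((x ord0 (lift ord0 i) + 1) / 2)].
pose u i := x ord0 (lift ord0 i) - 2 * (j i)%:~R.
have u1 i : -1 <= u i <= 1.
  rewrite /u ffunE.
  have := Num.Theory.floor_itv ((x ord0 (lift ord0 i) + 1) / 2).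
  by rewrite intrD => /andP[]; lra.
have [a va ua] := address_exists u `|x ord0 ord0| (normr_ge0 _) u1.
pose p : index := exist _ (j, x ord0 ord0 < 0, a) (ex_intro _ _ va).
exists p, (`|x ord0 ord0| - start a); split; first by rewrite subr_ge0 start_le.
rewrite /hair /= addrC subrK /chart /hairpt -[RHS]point_eta.
congr point; first by apply/funext => i; rewrite point_side ua /u addrC subrK.
by rewrite point_height [RHS]numEsign.
Qed.

(** Only the first point has to differ from its endpoint. Its positive height fixes the mirror
    image, its distance from the walls fixes the translate, and [address_unique] fixes the
    address. *)
Lemma hair_interior_disjoint (p q : index) s t : 0 < s -> 0 <= t ->
  hair p s = hair q t -> p = q.
Proof.
case: p q => [[[j b] a] ep] [[[j' b'] a'] eq] s0 t0 e.
have [[y vy] [y' vy']] := (ep, eq); rewrite /= in vy vy'.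
have va := start_valid a y vy; have va' := start_valid a' y' vy'.
have sa0 := valid_ge0 _ _ va; have sa0' := valid_ge0 _ _ va'.
have h0 : start a + s = start a' + t.
  have := hair_height (exist _ (j, b, a) ep) s (ltW s0).
  by rewrite e hair_height.
have bb : b = b'.
  have := congr1 (fun z : V => z ord0 ord0) e.
  rewrite /hair /= /chart !point_height -h0 => /(mulIf (lt0r_neq0 _)) sg.
  have : 0 < start a + s by lra.
  by move/sg; case: (b) (b') => -[] //=; rewrite expr0 expr1; lra.
have lt : start a < start a + s by rewrite ltrDl.
have side i : 2 * (j i)%:~R + trace a i (start a + s) =
    2 * (j' i)%:~R + trace a' i (start a + s).
  have := congr1 (fun z : V => z ord0 (lift ord0 i)) e.
  by rewrite /hair /= /chart !point_side -h0.
(* One side position is strictly inside (-1, 1) and the other in [-1, 1], while distinct centres are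
   at least 2 apart. *)
have jj : j = j'.
  apply/ffunP => i; have e1 := side i.
  have := off_wall a _ _ i va lt; rewrite ltr_norml => /andP[w1 w2].
  have w3 := trace_ge a' i (start a + s); have w4 := trace_le a' i (start a + s).
  case: (ltgtP (j i) (j' i)) => // jl.
    have : ((j i + 1)%:~R : R) <= (j' i)%:~R by rewrite ler_int lezD1.
    by rewrite intrD => ?; exfalso; lra.
  have : ((j' i + 1)%:~R : R) <= (j i)%:~R by rewrite ler_int lezD1.
  by rewrite intrD => ?; exfalso; lra.
have aa : a = a'.
  apply: (address_unique _ _ _ _ va lt).
    by rewrite h0; apply: valid_mono va'; rewrite lerDl.
  by move=> i; have := side i; rewrite jj => /addrI.
by subst; congr exist; exact: Prop_irrelevance.
Qed.

Definition hair_union : set V := \bigcup_p (hair p @` [set t | 0 < t]).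

Lemma hair_union_null s : 1 < s -> null s hair_union.
Proof.
move=> s1; have s0 : s != 0 by rewrite gt_eqF//; lra.
pose A (jb : symbol * bool) :=
  [set x | exists2 x', hair_interiors x' & x = chart jb.1 jb.2 x'].
apply: (@null_sub _ _ _ _ (\bigcup_jb A jb)).
  move=> _ [[[[j b] a] [y vy]] _ [t /= t0 <-]]; exists (j, b) => //.
  exists (hairpt a (start a + t)) => //; exists a, (start a), (start a + t).
  by split=> //; [exact: start_valid vy | rewrite ltrDl].
apply: null_bigcup => // jb.
apply: (@null_lip _ _ _ _ hair_interiors (fun x x' => x = chart jb.1 jb.2 x') 1) => //.
  by move=> x y x' y' -> ->; rewrite mul1r chart_dist.
exact: hair_interiors_null.
Qed.

Lemma hausdorff_dim_hair_union : hausdorff_dim hair_union = 1%:E.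
Proof.
apply/le_anti/andP; split.
  apply/lee_addgt0Pr => e e0; apply: ereal_inf_lbound; exists (1 + e) => //.
  split; first by rewrite addr_ge0// ltW.
  by apply: null_hausdorff; [lra | apply: hair_union_null; rewrite ltrDl].
apply: le_ereal_inf_tmp => _ [s [s0 Hs] <-]; rewrite lee_fin leNgt; apply/negP => s1.
have b0 (i : 'I_n) : -1 <= (0 : R) <= 1 by rewrite lerN10 ler01.
have [a va _] := address_exists (fun=> 0) 0 (lexx _) b0.
pose p : index := exist _ (0, false, a) (ex_intro _ _ va).
(* A single open hair projects onto all heights above its start, in particular onto this unit
   interval. *)
apply: (@hausdorff_projection _ _ s hair_union ord0 (start a + 1) s0 s1 _ Hs).
move=> h /andP[h1 h2]; exists (hair p (h - start a)).
  exists p => //; exists (h - start a) => //=.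
  by rewrite subr_gt0; apply: lt_le_trans h1; rewrite ltrDl.
by rewrite /hair /= /chart !point_height expr0 mul1r addrC subrK.
Qed.

End Hairs.

Theorem theorem1 (R : realType) (d : nat) (hd : (2 <= d)%N) :
  exists (I : Type) (gamma : I -> R -> 'rV[R]_d),
    (forall i, hair_param (gamma i)) /\
    \bigcup_i hair_of (gamma i) = [set: 'rV[R]_d] /\
    (forall i j, i <> j ->
       hair_of (gamma i) `&` hair_of (gamma j) = set0 \/
       (hair_of (gamma i) `&` hair_of (gamma j) = [set gamma i 0] /\
        gamma i 0 = gamma j 0)) /\
    hausdorff_dim (\bigcup_i (gamma i @` [set t | 0 < t])) = 1%:E.
Proof.
case: d hd => // n _; exists (@index R n), (@hair R n).
split; first exact: hair_is_hair.
split.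
  apply/seteqP; split=> // x _; have [p [t [t0 <-]]] := hairs_cover x.
  by exists p => //; exists t.
split; last exact: hausdorff_dim_hair_union.
move=> p q pq.
(* Applying disjointness in both directions shows that distinct hairs meet only where both
   parameters vanish. *)
have meet s t : 0 <= s -> 0 <= t -> hair p s = hair q t -> s = 0 /\ t = 0.
  move=> s0 t0 e; split.
    apply/eqP; move: s0; rewrite le_eqVlt => /orP[/eqP <-//|s0].
    by case: pq; exact: hair_interior_disjoint e.
  apply/eqP; move: t0; rewrite le_eqVlt => /orP[/eqP <-//|t0].
  by case: pq; apply/esym; exact: hair_interior_disjoint (esym e).
have [e0|ne0] := pselect (hair p 0 = hair q 0); [right | left].
  split=> //; apply/seteqP; split=> [_ [[s s0 <-] [t t0 e]]|_ ->].
    by have [-> _] := meet s t s0 t0 (esym e).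
  by split; exists 0 => //=.
apply/seteqP; split=> // _ [[s s0 <-] [t t0 e]].
by have [s00 t00] := meet s t s0 t0 (esym e); case: ne0; rewrite -{1}s00 -e t00.
Qed.
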